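(* Let $\Lambda\colon\mathbb{R}\to[0,1]$ be in standard representation and let $N_0:=\inf\{x\in\mathbb{R}\mid\Lambda(x)=0\}\in[-\infty,\infty]$. The following are equivalent: (a) $\Lambda$ is right lower semicontinuous, i.e. $\liminf_{y\downarrow x}\Lambda(y)\ge\Lambda(x)$ for all $x\in\mathbb{R}$. (b) For all $x\in\mathbb{R}$ with $x\le N_0$, it holds that $\Lambda(x)=\inf\{1-p\mid p\in[0,1],\ Q_\Lambda^-(B_{x,p})=x\}$. (c) For all $x\in\mathbb{R}$ with $x\le N_0$, it holds that $\Lambda(x)=\inf\{F(x)\mid F\in\mathcal M,\ Q_\Lambda^-(F)=x\}$.
   Context: $\mathcal M$ is the set of cumulative distribution functions on $\mathbb{R}$. For $F\in\mathcal M$, $Q_\Lambda^-(F):=\inf\{x\in\mathbb{R}\mid F(x)\ge\Lambda(x)\}\in[-\infty,\infty]$, with $\inf\varnothing=\infty$. $\Lambda$ is in standard representation if $\Lambda(x)=0$ for all real $x>N_0$. For $x\in\mathbb{R}$ and $p\in[0,1]$, $B_{x,p}:=(1-p)\mathbf 1_{[x,x+1)}+\mathbf 1_{[x+1,\infty)}\in\mathcal M$. *)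

(* Defs.v *)
From HB Require Import structures.
From mathcomp Require Import all_boot all_order all_algebra.
From mathcomp Require Import all_classical all_reals all_analysis.

Set Implicit Arguments.
Unset Strict Implicit.
Unset Printing Implicit Defensive.

Import Order.TTheory GRing.Theory Num.Theory.
Import numFieldNormedType.Exports.

Local Open Scope classical_set_scope.
Local Open Scope ring_scope.

(* The library's [cumulativeBounded 0 1] consists of the nondecreasing,
   right-continuous functions with limits 0 at -oo and 1 at +oo, i.e. of the
   cumulative distribution functions of the probability measures on R (see
   [cdf_lebesgue_stieltjes_id] and [lebesgue_stieltjes_cdf_id]). *)
Notation CDF R := (cumulativeBounded (0 : R) (1 : R)).

(* Infima are taken in [\bar R], where [ereal_inf set0 = +oo]. *)
Definition lambda_quantile (R : realType) (Lambda : R -> R) (F : CDF R)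
    : \bar R :=
  ereal_inf [set x%:E | x in [set x : R | Lambda x <= F x]].

Definition zero_threshold (R : realType) (Lambda : R -> R) : \bar R :=
  ereal_inf [set x%:E | x in [set x : R | Lambda x = 0]].

Definition standard_representation (R : realType) (Lambda : R -> R) : Prop :=
  forall x : R, (zero_threshold Lambda < x%:E)%E -> Lambda x = 0.

(* [x^'+] is the filter of punctured right neighbourhoods: [y = x] is
   excluded from the limit inferior. *)
Definition right_lower_semicontinuous (R : realType) (f : R -> R) : Prop :=
  forall x : R, ((f x)%:E <= limf_einf (fun y : R => (f y)%:E) x^'+)%E.

Definition two_point_cdf (R : realType) (x : R) (p : {i01 R}) : R -> R :=
  fun y => (1 - p%:num) * \1_(`[x, x + 1[) y + \1_(`[x + 1, +oo[) y.

Section two_point_cdf_is_cumulative.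
Context (R : realType) (x : R) (p : {i01 R}).

Lemma two_point_cdfE (y : R) : two_point_cdf x p y =
  if y < x then 0 else if y < x + 1 then 1 - p%:num else 1.
Proof.
rewrite /two_point_cdf !indicE !mem_setE !in_itv/= andbT.
move: (1 - p%:num) => q.
have [yx|xy] := ltP y x; have [yx1|xy1] := ltP y (x + 1) => /=.
- by rewrite mulr0 addr0.
- by have := le_lt_trans xy1 yx; rewrite ltNge lerDl ler01.
- by rewrite mulr1 addr0.
- by rewrite mulr0 add0r.
Qed.

Let p01 : (0 <= 1 - p%:num) && (1 - p%:num <= 1 :> R).
Proof. by rewrite subr_ge0 gerBl; apply/andP; split. Qed.

Let two_point_cdf_nd : nondecreasing (two_point_cdf x p).
Proof.
have /andP[p0 p1] := p01.
move=> y z yz; rewrite !two_point_cdfE.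
move: (1 - p%:num) p0 p1 => q q0 q1.
have [yx|xy] := ltP y x.
  by case: ifP => // _; case: ifP => // _; exact: ler01.
rewrite [z < x]ltNge (le_trans xy yz)/=.
have [yx1|xy1] := ltP y (x + 1); first by case: ifP.
by rewrite ltNge (le_trans xy1 yz).
Qed.

Let two_point_cdf_rc : right_continuous (two_point_cdf x p).
Proof.
move=> a; apply: cvg_near_cst.
suff: \forall y \near a^'+,
    (if y < x then 0 else if y < x + 1 then 1 - p%:num else 1) =
    (if a < x then 0 else if a < x + 1 then 1 - p%:num else 1).
  by apply: filterS => y; rewrite !two_point_cdfE.
move: (1 - p%:num) => q.
have [ax|xa] := ltP a x.
  near=> y.
  by have -> : y < x by near: y; exact: nbhs_right_lt.
have [ax1|xa1] := ltP a (x + 1).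
  near=> y.
  have xy : x <= y by rewrite (le_trans xa)//; near: y; exact: nbhs_right_ge.
  rewrite [y < x]ltNge xy/=.
  by have -> : y < x + 1 by near: y; exact: nbhs_right_lt.
near=> y.
have ay : a <= y by near: y; exact: nbhs_right_ge.
by rewrite !ltNge (le_trans xa ay) (le_trans xa1 ay).
Unshelve. all: by end_near. Qed.

HB.instance Definition _ :=
  isCumulative.Build R _ R (two_point_cdf x p) two_point_cdf_nd
    two_point_cdf_rc.

Let two_point_cdfNy : two_point_cdf x p @ -oo --> (0 : R).
Proof.
apply: cvg_near_cst; near=> y; rewrite two_point_cdfE.
by have -> : y < x by near: y; apply: nbhs_ninfty_lt; exact: num_real.
Unshelve. all: by end_near. Qed.

Let two_point_cdfy : two_point_cdf x p @ +oo --> (1 : R).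
Proof.
apply: cvg_near_cst; near=> y.
have xy : x + 1 <= y by near: y; apply: nbhs_pinfty_ge; exact: num_real.
by rewrite two_point_cdfE !ltNge xy (le_trans _ xy)// lerDl.
Unshelve. all: by end_near. Qed.

HB.instance Definition _ :=
  isCumulativeBounded.Build R 0 1 (two_point_cdf x p) two_point_cdfNy
    two_point_cdfy.

End two_point_cdf_is_cumulative.

(* Main.v *)
(** The quantile of [F] equals [x] exactly when [F < Lambda] on the left of [x]
and [Lambda <= F] holds at [x] or at points accumulating at [x] from the right.
For [x] below the zero threshold the first condition is automatic for
[two_point_cdf x p], whose value on [[x, x + 1[] is the constant [1 - p]; the
admissible levels [c = 1 - p] are thus those with [Lambda x <= c], together with
those for which [Lambda <= c] frequently at [x^'+].  Level [Lambda x] is always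
admissible, and a strictly smaller admissible level is precisely a failure of
right lower semicontinuity at [x]. *)

Require Import Defs.
From mathcomp Require Import all_boot all_order all_algebra.
From mathcomp Require Import all_classical all_reals all_analysis.
From mathcomp Require Import lra.

Set Implicit Arguments.
Unset Strict Implicit.
Unset Printing Implicit Defensive.

Import Order.TTheory GRing.Theory Num.Theory.
Import numFieldNormedType.Exports.

Local Open Scope classical_set_scope.
Local Open Scope ring_scope.

Section LambdaQuantile.
Variable R : realType.
Implicit Types (Lambda : R -> R) (F : CDF R) (x : R) (p : {i01 R}).

Lemma lambda_quantileP Lambda F x : lambda_quantile Lambda F = x%:E <->
  (forall y, y < x -> F y < Lambda y) /\
  ~ (F x < Lambda x /\ \forall y \near x^'+, F y < Lambda y).
Proof.
split=> [Qx|[Fx nFx]].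
  have ltx y : y < x -> F y < Lambda y.
    move=> yx; rewrite ltNge; apply/negP => Ly.
    have : (lambda_quantile Lambda F <= y%:E)%E
      by apply: ereal_inf_lbound; exists y.
    by rewrite Qx lee_fin leNgt yx.
  split=> // -[Lx]; apply/not_near_at_rightP => e.
  have /ereal_inf_lt[_ [y /= Ly <-]] :
      (lambda_quantile Lambda F < (x + e%:num)%:E)%E.
    by rewrite Qx lte_fin ltrDl.
  rewrite lte_fin => ye; exists y; last by apply/negP; rewrite -leNgt.
  rewrite ye andbT lt_neqAle; apply/andP; split.
    by apply: contraPneq Ly => <-; apply/negP; rewrite -ltNge.
  by rewrite leNgt; apply: contraTN Ly => /ltx; rewrite ltNge.
apply/eqP; rewrite eq_le; apply/andP; split; last first.
  apply/ereal_infP => _ [y /= Ly <-]; rewrite lee_fin leNgt.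
  by apply: contraTN Ly => /Fx; rewrite ltNge.
apply/lee_addgt0Pr => e e0; rewrite -EFinD.
have [Lx|Lx] := leP (Lambda x) (F x).
  by apply: ge_ereal_inf; exists x%:E; [exists x|rewrite lee_fin lerDl ltW].
have /not_near_at_rightP/(_ (PosNum e0))[y /andP[_ ye] /negP] :
  ~ (\forall y \near x^'+, F y < Lambda y) by move=> ?; exact: nFx.
rewrite -leNgt => Ly.
by apply: ge_ereal_inf; exists y%:E; [exists y|rewrite lee_fin ltW].
Qed.

(** The limit inferior is a supremum over right neighbourhoods [V] of infima over [V]: some [V]
    already exceeds a given level [c < f x], and conversely the set where [f] exceeds [f x - e] is
    itself such a [V]. *)
Lemma right_lower_semicontinuousP (f : R -> R) :
  right_lower_semicontinuous f <->
  forall x c, c < f x -> \forall y \near x^'+, c < f y.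
Proof.
split=> [fx x c cx|fx x].
  have := fx x; rewrite limf_einfE => fxsup.
  have /ereal_sup_gt[_ [V /= Vx <-] cV] :
    (c%:E < ereal_sup [set ereal_inf [set (f y)%:E | y in V] | V in x^'+])%E.
    by apply: lt_le_trans fxsup; rewrite lte_fin.
  apply: filterS Vx => y Vy; rewrite -lte_fin (lt_le_trans cV)//.
  by apply: ereal_inf_lbound; exists y.
apply/lee_subgt0Pr => e e0; rewrite limf_einfE -EFinB.
have fxe : \forall y \near x^'+, f x - e < f y.
  by apply: fx; rewrite ltrBlDr ltrDl.
apply: (@le_trans _ _
  (ereal_inf [set (f y)%:E | y in [set y | f x - e < f y]])).
  by apply/ereal_infP => _ [y /= xy <-]; rewrite lee_fin ltW.
by apply: ereal_sup_ubound; exists [set y | f x - e < f y].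
Qed.

Lemma two_point_cdf_id x p : two_point_cdf x p x = 1 - p%:num.
Proof. by rewrite two_point_cdfE ltxx ltrDl ltr01. Qed.

Lemma near_two_point_cdf x p :
  \forall y \near x^'+, two_point_cdf x p y = 1 - p%:num.
Proof.
near=> y; rewrite two_point_cdfE ltNge.
have -> /= : x <= y by near: y; exact: nbhs_right_ge.
by have -> : y < x + 1 by near: y; apply: nbhs_right_lt; rewrite ltrDl.
Unshelve. all: by end_near. Qed.

Section ZeroThreshold.
Variable Lambda : R -> R.
Hypothesis Lambda01 : forall x, 0 <= Lambda x <= 1.

Lemma lt_zero_threshold x y :
  (x%:E <= zero_threshold Lambda)%E -> y < x -> 0 < Lambda y.
Proof.
move=> xN yx; have /andP[L0 _] := Lambda01 y.
rewrite lt_neqAle L0 andbT; apply/eqP => /esym Ly.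
have : (zero_threshold Lambda <= y%:E)%E by apply: ereal_inf_lbound; exists y.
by move=> /(le_trans xN); rewrite lee_fin leNgt yx.
Qed.

(** Left of [x] the two-point function is 0 and [Lambda] is positive, so only the condition at [x]
    and just to its right remains; there the function is constantly [1 - p]. *)
Lemma lambda_quantile_two_point x p : (x%:E <= zero_threshold Lambda)%E ->
  lambda_quantile Lambda (two_point_cdf x p) = x%:E <->
  ~ (1 - p%:num < Lambda x /\ \forall y \near x^'+, 1 - p%:num < Lambda y).
Proof.
move=> xN; rewrite lambda_quantileP /= two_point_cdf_id.
have near_eq : (\forall y \near x^'+, two_point_cdf x p y < Lambda y) <->
    (\forall y \near x^'+, 1 - p%:num < Lambda y).
  by split; apply: filterS2 (near_two_point_cdf x p) => y ->.
rewrite near_eq; split=> [[]//|nL]; split=> // y yx.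
by rewrite two_point_cdfE yx (lt_zero_threshold xN).
Qed.

Lemma two_point_attaining x (c : R) : (x%:E <= zero_threshold Lambda)%E ->
  c <= 1 -> ~ (c < Lambda x /\ \forall y \near x^'+, c < Lambda y) ->
  exists2 p : {i01 R}, 1 - p%:num = c &
    lambda_quantile Lambda (two_point_cdf x p) = x%:E.
Proof.
(* A negative level lies below [Lambda] everywhere, against [nL]; hence [1 - c] is a legitimate
   parameter. *)
move=> xN c1 nL; have c0 : 0 <= c.
  rewrite leNgt; apply/negP => c0; apply: nL.
  have cL y : c < Lambda y by have /andP[+ _] := Lambda01 y; exact: lt_le_trans.
  by split=> //; exact: nearW.
have p0 : 0 <= 1 - c by rewrite subr_ge0.
have p1 : 1 - c <= 1 by rewrite gerBl.
exists (Itv01 p0 p1); first by rewrite /= subKr.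
by apply/(lambda_quantile_two_point _ xN); rewrite /= subKr.
Qed.

End ZeroThreshold.
End LambdaQuantile.

Theorem proposition3p3 (R : realType) (Lambda : R -> R)
    (Lambda01 : forall x : R, 0 <= Lambda x <= 1)
    (Lambda_std : standard_representation Lambda) :
  [<-> right_lower_semicontinuous Lambda;
       forall x : R, (x%:E <= zero_threshold Lambda)%E ->
         (Lambda x)%:E =
         ereal_inf [set (1 - p%:num)%:E | p in
           [set p : {i01 R} |
             lambda_quantile Lambda (two_point_cdf x p) = x%:E]];
       forall x : R, (x%:E <= zero_threshold Lambda)%E ->
         (Lambda x)%:E =
         ereal_inf [set (F x)%:E | F in
           [set F : CDF R | lambda_quantile Lambda F = x%:E]]].
Proof.
(* The level [Lambda x] is not strictly below itself, hence attained; this bounds both infima above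
   by [Lambda x]. *)
have attained x : (x%:E <= zero_threshold Lambda)%E ->
    exists2 p : {i01 R}, 1 - p%:num = Lambda x &
      lambda_quantile Lambda (two_point_cdf x p) = x%:E.
  have /andP[_ L1] := Lambda01 x.
  by move=> xN; apply: two_point_attaining => //; rewrite ltxx => -[].
tfae.
- move=> /right_lower_semicontinuousP rlsc x xN; apply/eqP; rewrite eq_le.
  apply/andP; split.
    apply/ereal_infP => _ [p /= + <-].
    move=> /(lambda_quantile_two_point Lambda01 _ xN) nL.
    (* Semicontinuity carries [1 - p < Lambda x] over to the points just right of [x], which [nL]
       forbids. *)
    rewrite lee_fin leNgt; apply/negP => pL.
    by apply: nL; split=> //; exact: rlsc.
  have [p <- Qp] := attained x xN.
  by apply: ereal_inf_lbound; exists p.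
- move=> b x xN; apply/eqP; rewrite eq_le; apply/andP; split; last first.
    have [p <- Qp] := attained x xN.
    apply: ereal_inf_lbound.
    by exists (two_point_cdf x p) => //=; rewrite two_point_cdf_id.
  apply/ereal_infP => _ [F /= /lambda_quantileP[_ nF] <-].
  rewrite lee_fin leNgt; apply/negP => FL.
  apply: nF; split=> //.
  (* A level strictly between [F x] and [Lambda x] absorbs the right
     continuity of [F] and is excluded by the two-point case. *)
  set c := (F x + Lambda x) / 2.
  have /andP[_ L1] := Lambda01 x.
  have cL : c < Lambda x by rewrite /c; lra.
  have Fc : F x < c by rewrite /c; lra.
  have Fy : \forall y \near x^'+, F y < c.
    by apply: cvgr_lt Fc; exact: cumulative_is_right_continuous.
  have : \forall y \near x^'+, c < Lambda y.
    (* Otherwise [c] would be an admissible two-point level, and (b) would give [Lambda x <= c]. *)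
    apply: contrapT => nL.
    have [p pE Qp] := two_point_attaining Lambda01 xN (ltW (lt_le_trans cL L1))
      (nL \o (@proj2 _ _)).
    suff : ((Lambda x)%:E <= c%:E)%E by rewrite lee_fin leNgt cL.
    by rewrite b//; apply: ereal_inf_lbound; exists p => //; rewrite pE.
  by apply: filterS2 Fy => y; exact: lt_trans.
- move=> c_; apply/right_lower_semicontinuousP => x c cL.
  have [xN|Nx] := leP x%:E (zero_threshold Lambda); last first.
    (* Beyond the threshold [Lambda] is 0 at [x] and at every [y > x]; the second rewrite turns that
       0 back into [Lambda x], which leaves [cL]. *)
    near=> y; rewrite (Lambda_std y) -?(Lambda_std x)//.
    apply: (lt_trans Nx); rewrite lte_fin.
    by near: y; exact: nbhs_right_gt.
  have /andP[_ L1] := Lambda01 x.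
  (* If semicontinuity fails at level [c], a two-point function with value [c] at [x] enters the
     infimum in (c) and forces [Lambda x <= c]. *)
  apply: contrapT => nL.
  have [p pE Qp] := two_point_attaining Lambda01 xN (ltW (lt_le_trans cL L1))
    (nL \o (@proj2 _ _)).
  suff : ((Lambda x)%:E <= c%:E)%E by rewrite lee_fin leNgt cL.
  rewrite c_//; apply: ereal_inf_lbound; exists (two_point_cdf x p) => //.
  by rewrite /= two_point_cdf_id pE.
Unshelve. all: by end_near. Qed.
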